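(* There is an absolute constant $C>0$ such that the following holds. Let $G(V,E)$ be a finite directed graph with $n=|V|$ and two distinguished vertices $s,t \in V$, and let $P$ be a balanced path from $s$ to $t$. Then there exists a balanced path $Q$ from $s$ to $t$ whose length is at most $C n^3$.
   Context: Let $G(V,E)$ be a directed graph and $G'(V,E')$ its underlying undirected graph, in which $u$ and $v$ are adjacent iff $(u,v)\in E$ or $(v,u)\in E$. A path from $s$ to $t$ is a walk in $G'$, i.e. a sequence of vertices $s=v_0,v_1,\dots,v_\ell=t$ with consecutive vertices adjacent in $G'$ (vertices and edges may repeat); its length is $\ell$. A traversed edge $(v_{j-1},v_j)$ of the path is neutral if both $(v_{j-1},v_j)\in E$ and $(v_j,v_{j-1})\in E$; forward if $(v_{j-1},v_j)\in E$ and $(v_j,v_{j-1})\notin E$; backward if $(v_{j-1},v_j)\notin E$ and $(v_j,v_{j-1})\in E$. A path is balanced if the number of forward edges along it (counted with multiplicity) equals the number of backward edges along it; it may contain any number of neutral edges. The bound $O(n^3)$ in the paper is interpreted as $\le Cn^3$ with $C$ independent of the graph. *)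

(* Defs.v *)
From mathcomp Require Import all_boot.

Set Implicit Arguments.
Unset Strict Implicit.
Unset Printing Implicit Defensive.

(* A directed graph on V is an arbitrary edge relation E : rel V (loops allowed;
   a traversed loop is a neutral edge). *)
Section BalancedPaths.

Variables (V : finType) (E : rel V).

Definition underlying : rel V := [rel u v | E u v || E v u].

Definition forward (e : V * V) : bool := E e.1 e.2 && ~~ E e.2 e.1.

Definition backward (e : V * V) : bool := ~~ E e.1 e.2 && E e.2 e.1.

(* A walk v_0, v_1, ..., v_l is given by its origin s = v_0 and the sequence
   p = [:: v_1; ...; v_l], so that its length is size p. *)
Definition walk (s t : V) (p : seq V) : Prop :=
  path underlying s p /\ last s p = t.

(* [:: (v_0, v_1); (v_1, v_2); ...; (v_(l-1), v_l)], with repetitions. *)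
Definition traversed (s : V) (p : seq V) : seq (V * V) := pairmap pair s p.

Definition balanced (s : V) (p : seq V) : Prop :=
  count forward (traversed s p) = count backward (traversed s p).

End BalancedPaths.

(* Main.v *)
Require Import Defs.
From mathcomp Require Import all_boot all_order all_algebra.
From mathcomp Require Import zify.

(** Weigh an edge +1, -1 or 0 according as it is forward, backward or neutral.
    Reversing a walk negates its weight.  If every closed walk at [s] of length
    at most [2n] has weight 0, then the weight of a walk from [s] depends only
    on its end point, and a shortest walk from [s] to [t] is balanced.
    Otherwise let [c] be such a closed walk of weight [w <> 0].  Excising loops
    in the product of the graph with Z/w, where a state is a pair (vertex,
    weight mod w), turns [P] into a walk of length less than [n|w|] from [s] to
    [t] whose weight is a multiple [k w] of [w]; then [|k| < n], and [|k|] turns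
    around [c] or its reverse restore balance.  The total length is at most
    [4n^2]. *)

Set Implicit Arguments.
Unset Strict Implicit.
Unset Printing Implicit Defensive.

Import Order.TTheory GRing.Theory Num.Theory.

Section Weight.

Variables (V : finType) (E : rel V).
Implicit Types (x y s t : V) (p q : seq V).

Local Open Scope ring_scope.

Fixpoint weight x p : int :=
  if p is y :: p' then (E x y)%:Z - (E y x)%:Z + weight y p' else 0.

Lemma weight_count x p :
  weight x p = (count (forward E) (traversed x p))%:Z
             - (count (backward E) (traversed x p))%:Z.
Proof.
elim: p x => [|y p IH] x //=; rewrite IH /forward /backward /=.
by case: (E x y); case: (E y x) => /=; lia.
Qed.

Lemma balancedP x p : balanced E x p <-> weight x p = 0.
Proof. by rewrite /balanced weight_count; split; lia. Qed.

Lemma weight_cat x p q : weight x (p ++ q) = weight x p + weight (last x p) q.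
Proof. by elim: p x => [|y p IH] x /=; rewrite ?add0r // IH addrA. Qed.

Lemma abs_weight x p : (`|weight x p| <= size p)%N.
Proof.
elim: p x => [|y p IH] x //=; have := IH y.
by case: (E x y); case: (E y x) => /=; lia.
Qed.

Definition reverse x p := rev (belast x p).

Lemma size_reverse x p : size (reverse x p) = size p.
Proof. by rewrite size_rev size_belast. Qed.

Lemma last_reverse x p : last (last x p) (reverse x p) = x.
Proof. by case: p => [|y p] //=; rewrite /reverse /= rev_cons last_rcons. Qed.

Lemma weight_reverse x p : weight (last x p) (reverse x p) = - weight x p.
Proof.
elim: p x => [|y p IH] x //=; rewrite /reverse /= rev_cons -cats1 weight_cat.
by rewrite IH last_reverse /=; lia.
Qed.

Lemma walk_cat s x t p q : walk E s x p -> walk E x t q -> walk E s t (p ++ q).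
Proof.
by move=> [pp pl] [qp ql]; split; rewrite ?cat_path ?last_cat pl ?pp ?qp.
Qed.

Lemma walk_reverse s t p : walk E s t p -> walk E t s (reverse s p).
Proof.
move=> [pp <-]; split; last exact: last_reverse.
by rewrite rev_path; apply: sub_path pp => a b; rewrite /underlying /= orbC.
Qed.

Definition turns k p := flatten (nseq k p).

Lemma walk_turns k s p : walk E s s p -> walk E s s (turns k p).
Proof.
by move=> pw; elim: k => [|k IH]; [split | apply: walk_cat pw IH].
Qed.

Lemma weight_turns k s p :
  walk E s s p -> weight s (turns k p) = k%:Z * weight s p.
Proof.
move=> [_ pl]; elim: k => [|k IH]; first by rewrite mul0r.
by rewrite /= weight_cat pl IH; lia.
Qed.

Lemma size_turns k p : size (turns k p) = (k * size p)%N.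
Proof. by elim: k => [|k IH] //=; rewrite size_cat IH mulSn. Qed.

(** If two prefixes end at the same vertex with the same label [f] of their weight, the segment
    between them can be cut out. The hypothesis on [f] says that the common suffix then preserves
    equality of labels. *)
Lemma excise_loops (T : finType) (f : int -> T) :
    (forall a b c : int, f a = f b -> f (a + c) = f (b + c)) ->
  forall s t p, walk E s t p ->
  exists q, [/\ walk E s t q, f (weight s q) = f (weight s p)
              & (size q < #|V| * #|T|)%N].
Proof.
move=> f_add s t p; have [m] := ubnP (size p).
elim: m p => // m IH p le_pm [pp pl].
have [lt_p|ge_p] := ltnP (size p) (#|V| * #|T|)%N; first by exists p.
(* There are [size p + 1] prefixes, counting the empty one, hence more prefixes than states. *)
pose g (i : 'I_(size p).+1) := (last s (take i p), f (weight s (take i p))).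
have /injectivePn[i0 [j0 ij0 gij0]] : ~~ injectiveb g.
  apply/injectiveP => /leq_card; rewrite card_ord card_prod => le_pn.
  by have := leq_trans le_pn ge_p; rewrite ltnn.
have [i [j [lt_ij gij]]] :
    exists i j : 'I_(size p).+1, (i < j)%N /\ g i = g j.
  case: (ltngtP i0 j0) => [lt_ij|lt_ji|/val_inj eq_ij].
  - by exists i0, j0.
  - by exists j0, i0.
  - by rewrite eq_ij eqxx in ij0.
case: gij => last_ij f_ij.
pose q := take i p ++ drop j p.
have le_jp : (j <= size p)%N by rewrite -ltnS.
have q_walk : walk E s t q.
  have split_p k : path (underlying E) s (take k p)
      && path (underlying E) (last s (take k p)) (drop k p).
    by rewrite -cat_path cat_take_drop.
  have /andP[ip _] := split_p i; have /andP[_ jp] := split_p j.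
  split; first by rewrite cat_path ip last_ij.
  by rewrite last_cat last_ij -last_cat cat_take_drop.
have q_f : f (weight s q) = f (weight s p).
  rewrite -[in RHS](cat_take_drop j p) !weight_cat last_ij.
  exact: f_add.
have lt_qp : (size q < size p)%N.
  rewrite size_cat size_drop size_takel; first by lia.
  by lia.
have [r [r_walk r_f r_size]] := IH q (leq_trans lt_qp le_pm) q_walk.
by exists r; split; rewrite ?r_f.
Qed.

Lemma short_walk s t p :
  walk E s t p -> exists2 q, walk E s t q & (size q < #|V|)%N.
Proof.
(* With a one-point label set, the states are just the vertices. *)
case/(excise_loops (f := fun=> tt)) => // q [q_walk _ q_size].
by exists q; rewrite // -[#|V|]muln1 -card_unit.
Qed.

Lemma walk_mod (m : nat) s t p : (0 < m)%N -> walk E s t p ->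
  exists q, [/\ walk E s t q, (weight s q = weight s p %[mod m])%Z
              & (size q < #|V| * m)%N].
Proof.
case: m => // m _.
pose f (a : int) : 'I_m.+1 := inord `|(a %% m.+1)%Z|%N.
have fE a b : f a = f b <-> (a = b %[mod m.+1])%Z.
  split=> [/(congr1 val)|eq_ab]; last by rewrite /f eq_ab.
  by rewrite /= !inordK; lia.
case/(excise_loops (f := f)) => [a b c /fE eq_ab|q [q_walk /fE q_f q_size]].
  by apply/fE; rewrite -modzDml eq_ab modzDml.
by exists q; split=> //; rewrite -[X in (_ * X)%N](card_ord m.+1).
Qed.

(** The bound leaves room for a loop made of two walks shorter than [#|V|] and one edge. *)
Definition flat s := forall p,
  walk E s s p -> (size p <= 2 * #|V|)%N -> weight s p = 0.

Lemma flatP s :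
  flat s \/ exists c, [/\ walk E s s c, (size c <= 2 * #|V|)%N & weight s c != 0].
Proof.
(* Sequences of bounded length form a finite type, so the alternative is decidable. *)
pose bad (c : (2 * #|V|).-bseq V) :=
  [&& path (underlying E) s c, last s c == s & weight s c != 0].
have [/existsP[c /and3P[cp /eqP cl cw]]|/existsPn no_bad] := boolP [exists c, bad c].
  by right; exists c; split=> //; apply: size_bseq.
left=> p [pp pl] p_size; apply/eqP; have := no_bad (Bseq p_size).
by rewrite /bad /= pp pl eqxx /= negbK.
Qed.

(** Induction on the last edge of [p]: the rest of [p] has the weight of a short walk [r], and [r],
    the last edge and the reverse of [q] form a closed walk short enough for flatness. *)
Lemma flat_weight s t p q : flat s ->
  walk E s t p -> walk E s t q -> (size q < #|V|)%N -> weight s p = weight s q.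
Proof.
move=> s_flat; elim/last_ind: p t q => [|p v IH] t q.
  by move=> [_ <-] q_walk q_size; rewrite (s_flat q) //; lia.
rewrite -cats1; move=> [+ pl] q_walk q_size.
rewrite cat_path /= andbT => /andP[pp pv].
have p_walk : walk E s (last s p) p by split.
have [r r_walk r_size] := short_walk p_walk.
rewrite weight_cat (IH _ _ p_walk r_walk r_size).
have tv : t = v by rewrite -pl last_cat.
have v_walk : walk E (last s p) t [:: v] by split; rewrite /= ?pv.
have loop := walk_cat (walk_cat r_walk v_walk) (walk_reverse q_walk).
have := s_flat _ loop; rewrite !size_cat size_reverse /=.
have -> : (size r + 1 + size q <= 2 * #|V|)%N by lia.
move=> /(_ isT).
rewrite !weight_cat last_cat (proj2 r_walk) /= -tv.
by case: (q_walk) => _ <-; rewrite weight_reverse /=; lia.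
Qed.

End Weight.

Theorem theorem2 :
  exists C : nat, 0 < C /\
    forall (V : finType) (E : rel V) (s t : V) (P : seq V),
      walk E s t P -> balanced E s P ->
      exists Q : seq V,
        [/\ walk E s t Q, balanced E s Q & size Q <= C * #|V| ^ 3].
Proof.
exists 4; split=> // V E s t P P_walk /balancedP P_bal.
have V_gt0 : 0 < #|V| by apply/card_gt0P; exists s.
have [s_flat|[c [c_walk c_size c_neq0]]] := flatP E s.
  have [Q Q_walk Q_size] := short_walk P_walk.
  exists Q; split=> //; last by rewrite !expnS; nia.
  by apply/balancedP; rewrite -(flat_weight s_flat P_walk Q_walk Q_size).
pose m := `|weight E s c|%N.
have m_gt0 : 0 < m by rewrite absz_gt0.
have m_le : m <= 2 * #|V| by apply: leq_trans c_size; apply: abs_weight.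
have [q [q_walk q_mod q_size]] := walk_mod m_gt0 P_walk.
pose k := `|weight E s q|%N %/ m.
have km : k * m = `|weight E s q|%N.
  apply: divnK; move: q_mod; rewrite P_bal mod0z => /dvdz_mod0P.
  by rewrite dvdzE.
(* Here [k * m] is at most the length of [q], which is below [#|V| * m]. *)
have k_lt : k < #|V|.
  rewrite -(ltn_pmul2r m_gt0) km; exact: leq_ltn_trans (abs_weight _ _ _) q_size.
have [d [d_walk d_size d_weight]] : exists d, [/\ walk E s s d,
    size d <= 2 * #|V| & (weight E s q + k%:Z * weight E s d)%R = 0%R].
  have [_ cl] := c_walk.
  have rev_w : weight E s (reverse s c) = (- weight E s c)%R.
    by rewrite -{1}cl weight_reverse.
  (* The weight of [q] is [k] times that of [c] up to sign; the sign decides the direction in which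
     [c] is run. *)
  have [sgn|sgn] : (weight E s q + k%:Z * weight E s c = 0)%R \/
      (weight E s q - k%:Z * weight E s c = 0)%R by rewrite /m in km; nia.
  - by exists c.
  - exists (reverse s c); split; first exact: walk_reverse.
      by rewrite size_reverse.
    by rewrite rev_w mulrN.
exists (turns k d ++ q); split.
- exact: walk_cat (walk_turns k d_walk) q_walk.
- have [_ dl] := walk_turns k d_walk.
  by apply/balancedP; rewrite weight_cat dl weight_turns // addrC.
(* With [n = #|V|], both [k * size d] and [size q] are at most [2n^2], and [n >= 1] gives
   [4n^2 <= 4n^3]. *)
- by rewrite size_cat size_turns !expnS expn0; nia.
Qed.
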